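(* Every finite retract of a sociable graph is sociable.
   Context: A graph is a pair $(V,E)$ where $E$ is a symmetric and reflexive binary relation on $V$ (every vertex has a loop). A homomorphism is an edge-preserving map (it may collapse edges). A retraction of $X$ onto $Y\subseteq X$ is a homomorphism $X\to Y$ (with $Y$ the induced subgraph) that is the identity on $Y$; then $Y$ is a retract of $X$. A (finite or countably infinite) graph $X$ is sociable if $X=\bigcup_{n\in\omega}X_n$ where the $X_n$ are finite induced subgraphs, $|X_0|=1$, $X_n\subseteq X_{n+1}$, $|X_{n+1}\setminus X_n|\leq 1$, and for each $n$ there is a retraction $p_n$ of $X_{n+1}$ onto $X_n$ such that, if $X_{n+1}\setminus X_n=\{w\}$, then $w$ is adjacent to $p_n(w)$. *)

(* Defs.v *)
From mathcomp Require Import all_boot.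
From mathcomp Require Import boolp classical_sets functions cardinality.

Set Implicit Arguments.
Unset Strict Implicit.
Unset Printing Implicit Defensive.

Local Open Scope classical_set_scope.
Local Open Scope card_scope.

Record graph : Type := Graph {
  vertex :> Type;
  adj : vertex -> vertex -> Prop;
  adj_refl : forall x, adj x x;
  adj_sym : forall x y, adj x y -> adj y x
}.

Definition induced (G : graph) (A : set G) : graph :=
  @Graph (set_type A) (fun x y => adj (set_val x) (set_val y))
    (fun x => adj_refl (set_val x))
    (fun x y => @adj_sym G (set_val x) (set_val y)).

(* Subgraphs of G are always induced, hence given by their vertex sets. A map
   from the subgraph on A to the subgraph on B is represented by a map p from G
   to G sending A into B; the values of p outside A are irrelevant. *)
Definition retraction (G : graph) (A B : set G) (p : G -> G) : Prop :=
  [/\ B `<=` A,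
      forall x, A x -> B (p x),
      forall x y, A x -> A y -> adj x y -> adj (p x) (p y)
    & forall x, B x -> p x = x].

Definition retract (G : graph) (Y : set G) : Prop :=
  exists r : G -> G, retraction [set: G] Y r.

Definition sociable (G : graph) : Prop :=
  countable [set: G] /\
  exists X : nat -> set G,
    [/\ [set: G] = \bigcup_n X n,
        forall n, finite_set (X n),
        X 0 #= `I_1
      & forall n,
        [/\ X n `<=` X n.+1,
            X n.+1 `\` X n #<= `I_1
          & exists p : G -> G,
              retraction (X n.+1) (X n) p /\
              forall w, X n.+1 `\` X n = [set w] -> adj w (p w)]].

(* Main.v *)
Require Import Defs.
From mathcomp Require Import all_boot.
From mathcomp Require Import boolp classical_sets functions cardinality.
From mathcomp Require Import finmap.

(** Dismantling a finite graph means deleting, one at a time, vertices [w] that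
    are dominated, i.e. whose closed neighbourhood is contained in that of
    another vertex [v], until one vertex is left; a finite sociable graph is a
    dismantlable one. Let [Y] be a finite retract of [X], say [Y] is contained
    in the dismantlable stage [X_n]. Composing [Y -> X_n] with the successive
    folds [w |-> v] and then with the retraction onto [Y] gives endomorphisms
    of [Y], consecutive ones sending adjacent vertices to adjacent vertices; the
    first is the identity and the last is constant. If [Y] is not a point, then
    the first one that differs from the identity moves a vertex to one that
    dominates it. Deleting this dominated vertex leaves a smaller retract of
    [X], and the argument is repeated. *)

Set Implicit Arguments.
Unset Strict Implicit.
Unset Printing Implicit Defensive.

Local Open Scope classical_set_scope.
Local Open Scope card_scope.

(** Induction on cardinality; it serves both to place a finite set inside one stage of a chain and
    to delete dominated vertices one by one. *)
Lemma finite_setD1_ind (T : Type) (P : set T -> Prop) :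
    (forall A, finite_set A -> (forall w, A w -> P (A `\ w)) -> P A) ->
  forall A, finite_set A -> P A.
Proof.
move=> IH A Afin; have [m] := ubnP #|` fset_set (A : set {classic T})|%fset.
elim: m A Afin => // m IHm A Afin; rewrite ltnS => leAm.
apply: IH => // w Aw; apply: IHm; first exact: finite_setD.
apply: leq_trans leAm; rewrite (fset_setD1 (w : {classic T})) //.
apply/fproper_ltn_card/fproperD1; rewrite in_fset_set //; exact: mem_set.
Qed.

Lemma finite_subset_nondecreasing_bigcup (T : Type) (F : nat -> set T)
    (A : set T) :
    (forall n, F n `<=` F n.+1) -> finite_set A -> A `<=` \bigcup_n F n ->
  exists n, A `<=` F n.
Proof.
move=> FS Afin.
have Fmono m n : (m <= n)%N -> F m `<=` F n.
  move=> /subnKC <-; elim: (n - m)%N => [|k IH]; first by rewrite addn0.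
  by rewrite addnS; exact: subset_trans IH (FS _).
elim/finite_setD1_ind: A / Afin => A _ IH AF.
have [->|/set0P[w Aw]] := eqVneq A set0; first by exists 0%N.
have [k Fkw] : exists k, F k w by have [k _ ?] := AF _ Aw; exists k.
have [n An] := IH w Aw (fun x Ax => AF x (proj1 Ax)).
exists (maxn k n) => x Ax; have [->|xw] := pselect (x = w).
  exact: Fmono (leq_maxl _ _) _ Fkw.
by apply: Fmono (leq_maxr _ _) _ _; apply: An.
Qed.

Lemma card_le_I1P (T : Type) (A : set T) :
  A #<= `I_1 <-> A = set0 \/ exists x, A = [set x].
Proof.
split=> [/pcard_leP[f]|[->|[x ->]]]; last 2 first.
- exact: card_ge0.
- by have := @card_set1 T x; rewrite card_eq_le => /andP[].
have [->|/set0P[x Ax]] := eqVneq A set0; [by left|right; exists x].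
apply/seteqP; split=> [y Ay|_ ->//].
apply: (@inj _ _ _ f); [exact: mem_set|exact: mem_set|].
have := @funS _ _ _ _ f _ Ax; have := @funS _ _ _ _ f _ Ay.
by rewrite /= !ltnS !leqn0 => /eqP -> /eqP ->.
Qed.

Lemma card_eq_I1P (T : Type) (A : set T) :
  A #= `I_1 <-> exists x, A = [set x].
Proof.
split=> [A1|[x ->]]; last exact: card_set1.
have : A #<= `I_1 by move: A1; rewrite card_eq_le => /andP[].
move=> /card_le_I1P[A0|//]; move: A1.
by rewrite A0 card_eq_sym card_eq0 => /eqP/seteqP[/(_ 0%N (erefl _))].
Qed.

(* Since every vertex has a loop, [u = w] makes [v] adjacent to [w]. *)
Definition dominates (G : graph) (A : set G) (v w : G) : Prop :=
  forall u, A u -> adj w u -> adj v u.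

(** Built up from a single vertex, so that induction deals with the last added vertex, the first one
    to be deleted. All sets live in one ambient graph, which avoids a change of type at each
    step. *)
Inductive dismantlable (G : graph) : set G -> Prop :=
| dismantlable1 x : dismantlable [set x]
| dismantlableU A v w : dismantlable A -> A v -> ~ A w ->
    dominates (w |` A) v w -> dismantlable (w |` A).

Lemma retraction_id (G : graph) (A : set G) : retraction A A id.
Proof. by split. Qed.

Definition fold (G : graph) (v w x : G) : G := if pselect (x = w) then v else x.

Lemma foldE (G : graph) (v w : G) : fold v w w = v.
Proof. by rewrite /fold; case: pselect. Qed.

Lemma fold_id (G : graph) (v w x : G) : x <> w -> fold v w x = x.
Proof. by rewrite /fold; case: pselect. Qed.

Lemma fold_setU1 (G : graph) (A : set G) (v w x : G) :
  A v -> (w |` A) x -> A (fold v w x).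
Proof. by move=> Av; rewrite /fold; case: pselect => // xw [/xw|]. Qed.

Lemma adj_fold (G : graph) (A : set G) (v w x y : G) :
  dominates A v w -> A y -> adj x y -> adj (fold v w x) y.
Proof. by rewrite /fold; case: pselect => //= -> + Ay; apply. Qed.

Lemma retraction_fold (G : graph) (A : set G) (v w : G) :
    A v -> ~ A w -> dominates (w |` A) v w ->
  retraction (w |` A) A (fold v w).
Proof.
move=> Av Aw dom; split=> [x Ax|x|x y Ax Ay xy|x Ax]; first by right.
- exact: fold_setU1.
(* The endpoints are folded one at a time: [x] against the folded [y], then [y] against [x] by
   symmetry. *)
- apply: (adj_fold dom); first by right; exact: fold_setU1.
  by apply/adj_sym/(adj_fold dom) => //; exact/adj_sym.
- by apply: fold_id => xw; rewrite xw in Ax.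
Qed.

(** The retraction onto [Y] is followed by the fold of [w] onto [v]. *)
Lemma retract_setD1 (G : graph) (Y : set G) (v w : G) :
  retract Y -> (Y `\ w) v -> Y w -> dominates Y v w -> retract (Y `\ w).
Proof.
move=> [r [_ rY radj rid]] Yv Yw.
rewrite -{1}(setD1K Yw) => dom.
have [_ fY fadj fid] := retraction_fold Yv (fun H => proj2 H erefl) dom.
rewrite (setD1K Yw) in fY fadj.
exists (fold v w \o r); split=> //= [x _|x y _ _ xy|x Yx].
- exact/fY/rY.
- by apply: fadj; [exact: rY|exact: rY|exact: radj].
- by rewrite rid ?fid//; case: Yx.
Qed.

(** Here [f] and [g] exhibit [Y] as a retract of [A]. If [f] is followed by a fold, then [g] takes
    the result at [y] to a vertex dominating [y], hence to [y] itself; so [g] remains a left inverse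
    while [A] shrinks to a point. *)
Lemma retract_undominated (G : graph) (A Y : set G) (f g : G -> G) :
    dismantlable A ->
    (forall v w, Y v -> Y w -> dominates Y v w -> v = w) ->
    (forall y, Y y -> A (f y)) ->
    (forall x y, Y x -> Y y -> adj x y -> adj (f x) (f y)) ->
    (forall x, A x -> Y (g x)) ->
    (forall x y, A x -> A y -> adj x y -> adj (g x) (g y)) ->
    (forall y, Y y -> g (f y) = y) ->
  exists x, Y = [set x].
Proof.
move=> disA undom.
elim: A / disA f g => [x|A v w _ IH Av Aw dom] f g fA fadj gY gadj gf.
  exists (g x); apply/seteqP; split=> [y Yy|_ ->]; last exact: gY.
  by rewrite /= -(gf _ Yy) (fA _ Yy).
have [_ pA padj _] := retraction_fold Av Aw dom.
apply: (IH (fold v w \o f) g) => [y Yy|x y Yx Yy xy|x Ax|x y Ax Ay|y Yy] /=.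
- exact/pA/fA.
- by apply: padj; [exact: fA|exact: fA|exact: fadj].
- by apply: gY; right.
- by apply: gadj; right.
- have Apfy : A (fold v w (f y)) by exact/pA/fA.
  apply: undom => // [|u Yu yu]; first by apply: gY; right.
  rewrite -(gf _ Yu); apply: gadj; [by right|exact: fA|].
  by apply: (adj_fold dom); [exact: fA|exact: fadj].
Qed.

(** If [u] in [X n] is adjacent to the new vertex [w], then [p u = u] is adjacent to [p w]; as [w]
    is also adjacent to [p w], the vertex [p w] dominates [w]. *)
Lemma dismantlable_stage (G : graph) (X : nat -> set G) :
    X 0%N #= `I_1 ->
    (forall n,
      [/\ X n `<=` X n.+1,
          X n.+1 `\` X n #<= `I_1
        & exists p : G -> G,
            retraction (X n.+1) (X n) p /\
            forall w, X n.+1 `\` X n = [set w] -> adj w (p w)]) ->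
  forall n, dismantlable (X n).
Proof.
move=> /card_eq_I1P[x X0] XS; elim=> [|n IH]; first by rewrite X0; constructor.
have [sX /card_le_I1P XD [p [[_ pX padj pid] wp]]] := XS n.
have XE : X n.+1 = (X n.+1 `\` X n) `|` X n by rewrite setUC setDUK.
case: XD => [X0'|[w Xw]]; first by rewrite XE X0' set0U.
have [Sw nXw] : (X n.+1 `\` X n) w by rewrite Xw.
rewrite XE Xw; apply: (@dismantlableU _ _ (p w)) => //; first exact: pX.
move=> u [->|Xu] wu; first exact/adj_sym/wp.
by rewrite -(pid _ Xu); apply: padj => //; exact: sX.
Qed.

Lemma dismantlable_finite_retract (G : graph) (Y : set G) :
  sociable G -> finite_set Y -> retract Y -> dismantlable Y.
Proof.
move=> [_ [X [XT _ X0 XS]]] Yfin.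
have [n YX] : exists n, Y `<=` X n.
  apply: finite_subset_nondecreasing_bigcup => //; last by rewrite -XT.
  by move=> n; have [] := XS n.
have disX := dismantlable_stage X0 XS n.
(* The stage [X n] is fixed before the induction: it still contains every set obtained from [Y] by
   deletions. *)
elim/finite_setD1_ind: Y / Yfin YX => Y _ IH YX Yret.
have [[v [w [Yv Yw vw dom]]]|undom] :=
    pselect (exists v w, [/\ Y v, Y w, v <> w & dominates Y v w]).
  rewrite -(setD1K Yw); apply: (@dismantlableU _ _ v w) => //.
  - apply: IH => //; first by move=> x [/YX].
    exact: retract_setD1 dom.
  - by case=> _; apply.
  - by rewrite setD1K.
have [r [_ rY radj rid]] := Yret.
have [x ->] : exists x, Y = [set x]; last exact: dismantlable1.
apply: (@retract_undominated _ _ _ id r disX) => // [v w Yv Yw dom|x _|x y _ _].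
- by apply: contrapT => vw; apply: undom; exists v, w.
- exact: rY.
- exact: radj.
Qed.

(** Proved for every [A] inside [Y], since the induction shrinks [A] while the ambient graph
    [induced Y] has to stay the same. *)
Lemma dismantlable_induced (G : graph) (A Y : set G) :
  dismantlable A -> A `<=` Y ->
  dismantlable [set y : induced Y | A (set_val y)].
Proof.
elim=> [x|{}A v w _ IH Av Aw dom] AY.
  have Yx : x \in Y by apply: mem_set; exact: AY.
  suff -> : [set y : induced Y | [set x] (set_val y)] =
      [set (exist _ x Yx : induced Y)] by exact: dismantlable1.
  by apply/seteqP; split=> [y /= yx|_ ->//]; apply: val_inj.
have Yv : v \in Y by apply/mem_set/AY; right.
have Yw : w \in Y by apply/mem_set/AY; left.
have -> : [set y : induced Y | (w |` A) (set_val y)] =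
    (exist _ w Yw : induced Y)
      |` [set y : induced Y | A (set_val y)].
  apply/seteqP; split=> y /= [yw|Ay]; [|by right| |by right].
  - by left; apply: val_inj.
  - by left; rewrite yw.
apply: (@dismantlableU _ _ (exist _ v Yv : induced Y)) => //.
- by apply: IH => x Ax; apply: AY; right.
- move=> u Au; apply: dom; case: Au => [->|Au]; [by left|by right].
Qed.

Lemma dismantlable_finite (G : graph) (A : set G) :
  dismantlable A -> finite_set A.
Proof. by elim=> // {}A v w _ Afin _ _ _; rewrite finite_setU. Qed.

Lemma dismantlable_chain (G : graph) (A : set G) :
  dismantlable A -> exists (X : nat -> set G) (N : nat),
    [/\ X N = A, forall n, finite_set (X n), X 0%N #= `I_1 & forall n,
        [/\ X n `<=` X n.+1,
            X n.+1 `\` X n #<= `I_1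
          & exists p : G -> G,
              retraction (X n.+1) (X n) p /\
              forall w, X n.+1 `\` X n = [set w] -> adj w (p w)]].
Proof.
elim=> [x|{}A v w disA [X [N [XN Xfin X0 XS]]] Av Aw dom].
  exists (fun=> [set x]), 0%N; split=> [|||n]; [by []|by []|exact: card_set1|].
  split=> //; first by rewrite setDv; exact: card_ge0.
  by exists id; split=> [|y _]; [exact: retraction_id|exact: adj_refl].
(* The old chain is followed up to [N], where it equals [A]; from then on it is constant, with [w]
   added. The only new retraction is the fold at [N]; the later ones are identities. *)
exists (fun n => if (n <= N)%N then X n else w |` A), N.+1; split=> //.
- by rewrite ltnn.
- move=> n; case: ifP => // _; rewrite finite_setU; split=> //.
  exact: dismantlable_finite.
move=> n; have [nN|Nn|->] := ltngtP n N.
- exact: XS.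
- split=> //; first by rewrite setDv; exact: card_ge0.
  by exists id; split=> [|y _]; [exact: retraction_id|exact: adj_refl].
- rewrite XN; have AD : (w |` A) `\` A = [set w].
    by rewrite setDUl setDv setU0; apply/seteqP; split=> [x []|x ->].
  split; first by move=> x; right.
    by rewrite AD; apply/card_le_I1P; right; exists w.
  exists (fold v w); split; first exact: retraction_fold.
  move=> x; rewrite AD => /seteqP[/(_ w erefl) /= <- _].
  by rewrite foldE; apply/adj_sym/dom; [left|exact: adj_refl].
Qed.

Lemma dismantlable_sociable (G : graph) :
  dismantlable [set: G] -> sociable G.
Proof.
move=> disG; split; first exact/finite_set_countable/dismantlable_finite.
have [X [N [XN Xfin X0 XS]]] := dismantlable_chain disG.
exists X; split=> //; apply/seteqP; split=> // x _.
(* Stage [N] is already the whole graph. *)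
by exists N; rewrite ?XN.
Qed.

Theorem theorem6p5 (X : graph) (Y : set X) (hX : sociable X)
  (hfin : finite_set Y) (hret : retract Y) : sociable (induced Y).
Proof.
apply: dismantlable_sociable.
have disY := dismantlable_finite_retract hX hfin hret.
have := dismantlable_induced disY (@subset_refl _ Y).
suff -> : [set y : induced Y | Y (set_val y)] = setT by [].
by apply/seteqP; split=> // y _; exact: set_mem (valP y).
Qed.
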